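(* On a periodic domain, let $\nu>0$ and $\tau_e>0$, and suppose that a periodic vector field $\bm\alpha$ and a periodic scalar field $\pi$ satisfy $$\nu\Delta\bm\alpha-\tau_e^{-1}\bm\alpha=\nabla\pi,\qquad \nabla\cdot\bm\alpha=0 .$$ Then $\bm\alpha=0$ and $\nabla\pi=0$.
   Context: A periodic domain is a flat torus $\mathbb R^d/\Lambda$ ($\Lambda$ a full-rank lattice); all fields, including $\pi$ itself, are (sufficiently regular) functions on it. $\nu$ is the kinematic viscosity. *)

(* Defs.v *)
From HB Require Import structures.
From mathcomp Require Import all_boot all_order all_algebra.
From mathcomp Require Import all_classical all_reals all_analysis.

Set Implicit Arguments.
Unset Strict Implicit.
Unset Printing Implicit Defensive.

Import Order.TTheory GRing.Theory Num.Theory.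
Import numFieldNormedType.Exports.

Local Open Scope classical_set_scope.
Local Open Scope ring_scope.

(* A field on the flat torus R^d / L is represented by its lift to R^d, that
   is, by a function on 'rV[R]_d invariant under translation by every element
   of L. Partial derivatives are those of the lift. The norm of 'rV[R]_d is the
   sup norm, but only its topology matters here. *)

(* The rows of B form a basis of R^d, and L is the set of their integer linear
   combinations. *)
Definition full_rank_lattice (R : realType) (d : nat) (L : set 'rV[R]_d) :=
  exists2 B : 'M[R]_d, B \in unitmx &
    L = range (fun z : 'rV[int]_d => map_mx intr z *m B).

Definition lattice_periodic (R : realType) (d : nat) (V : zmodType)
    (L : set 'rV[R]_d) (f : 'rV[R]_d -> V) :=
  forall l, L l -> periodic f l.

Section DifferentialOperators.
Context {R : realType} {d : nat}.

Definition partial {V : normedModType R} (i : 'I_d) (f : 'rV[R]_d -> V)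
  : 'rV[R]_d -> V := 'D_(delta_mx 0 i) f.

(* Outside of derivability points 'D_v f has a junk value, so that existence of
   the partial derivatives has to be required separately. *)
Fixpoint Ck {V : normedModType R} (k : nat) (f : 'rV[R]_d -> V) : Prop :=
  continuous f /\
  if k is k'.+1 then
    forall i : 'I_d, (forall x, derivable f x (delta_mx 0 i)) /\
                     Ck k' (partial i f)
  else True.

Definition laplacian {V : normedModType R} (f : 'rV[R]_d -> V) (x : 'rV[R]_d)
  : V := \sum_(i < d) partial i (partial i f) x.

Definition grad (p : 'rV[R]_d -> R^o) (x : 'rV[R]_d) : 'rV[R]_d :=
  \row_(i < d) partial i p x.

Definition div (a : 'rV[R]_d -> 'rV[R]_d) (x : 'rV[R]_d) : R :=
  \sum_(i < d) partial i (fun y => a y 0 i : R^o) x.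

End DifferentialOperators.

(* Main.v *)
(* Energy argument without integrals. By incompressibility and the momentum
   equation, nu |grad alpha|^2 + tau_e^-1 |alpha|^2 is the divergence of the
   periodic C^1 field G_i = nu alpha . d_i alpha - p alpha_i, so it suffices that
   a nonnegative divergence F of a periodic C^1 field vanishes. If F x0 > 0, then
   by compactness finitely many translates of F add up to at least a constant
   c > 0. Replacing partial derivatives by difference quotients (uniformly close
   on the torus) produces a finite sum of differences f (x + v) - f x of bounded
   functions that is everywhere at least a positive constant; averaging
   successively along each v, where the differences telescope, shows that this is
   impossible. *)

Require Import Defs.
From HB Require Import structures.
From mathcomp Require Import all_boot all_order all_algebra.
From mathcomp Require Import all_classical all_reals all_analysis.
From mathcomp Require Import ring lra.

Set Implicit Arguments.
Unset Strict Implicit.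
Unset Printing Implicit Defensive.

Import Order.TTheory GRing.Theory Num.Theory.
Import numFieldNormedType.Exports.

Local Open Scope classical_set_scope.
Local Open Scope ring_scope.

(** * Averaging of bounded differences *)

(** Induction on [s]: averaging the inequality over many steps along the head vector makes the head
    difference telescope to something small. The tail keeps its form, with averaged functions that
    satisfy the same bounds, and still has a lower bound of half the constant. *)
Lemma sum_bounded_differences_le0 (R : archiRealFieldType) (V : zmodType)
    (I : Type) (s : seq I) (v : I -> V) (f : I -> V -> R) (c : R) :
  (forall i, exists M, forall x, `|f i x| <= M) ->
  (forall x, c <= \sum_(i <- s) (f i (x + v i) - f i x)) -> c <= 0.
Proof.
elim: s f c => [|i s IHs] f c fM cle.
  by have := cle 0; rewrite big_nil.
rewrite leNgt; apply/negP => c0.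
have [M Mi] := fM i.
(* The telescoped head term is at most [2 * M / N], and this choice makes it at most [c / 2]. The
   successor keeps [N] positive. *)
pose N := (Num.bound (4 * M / c)).+1.
have N0 : 0 < N%:R :> R by rewrite ltr0n.
have MN : 4 * M <= c * N%:R.
  rewrite [c * _]mulrC -ler_pdivrMr//.
  have M0 : 0 <= 4 * M / c.
    have := le_trans (normr_ge0 _) (Mi 0) => {}M0.
    rewrite divr_ge0 ?(ltW c0)//; lra.
  by apply: le_trans (ltW (archi_boundP M0)) _; rewrite ler_nat.
pose g j x := N%:R^-1 * \sum_(k < N) f j (x + v i *+ k).
suff : c / 2 <= 0 by lra.
apply: (IHs g) => [j|x].
  have [m mj] := fM j; exists m => x.
  rewrite normrM ger0_norm ?invr_ge0 ?ler0n// ler_pdivrMl//.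
  apply: le_trans (ler_norm_sum _ _ _) _.
  apply: le_trans (ler_sum _ (fun k _ => mj _)) _.
  by rewrite sumr_const card_ord mulr_natl.
have -> : \sum_(j <- s) (g j (x + v j) - g j x) =
  N%:R^-1 * \sum_(k < N) \sum_(j <- s)
     (f j (x + v i *+ k + v j) - f j (x + v i *+ k)).
  rewrite exchange_big/= mulr_sumr; apply: eq_bigr => j _.
  rewrite /g -mulrBr -sumrB; congr (_ * _); apply: eq_bigr => k _.
  by rewrite addrAC.
have tele : \sum_(k < N) (f i (x + v i *+ k + v i) - f i (x + v i *+ k)) =
    f i (x + v i *+ N) - f i x.
  under eq_bigr => k _ do rewrite -addrA -mulrSr.
  rewrite -(big_mkord xpredT
    (fun k => f i (x + v i *+ k.+1) - f i (x + v i *+ k))).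
  by rewrite telescope_sumr// mulr0n addr0.
have : \sum_(k < N) c <= \sum_(k < N) \sum_(j <- i :: s)
     (f j (x + v i *+ k + v j) - f j (x + v i *+ k)).
  by apply: ler_sum => k _; exact: cle.
under [X in _ <= X]eq_bigr => k _ do rewrite big_cons.
rewrite big_split/= tele sumr_const card_ord -mulr_natr ler_pdivlMl//.
have := Mi (x + v i *+ N); have := Mi x; rewrite !ler_norml.
move=> /andP[? ?] /andP[? ?]; lra.
Qed.

(** * Compactness of the torus *)

Lemma lattice_compact_reduction (R : realType) (d : nat) (L : set 'rV[R]_d) :
  full_rank_lattice L ->
  exists2 K : set 'rV[R]_d, compact K &
    forall x, exists2 l, L l & K (x + l).
Proof.
move=> [B Bu ->].
(* [K] is a box that contains a fundamental cell. Subtracting the floors of the coordinates in the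
   basis [B] leaves coefficients in [0, 1), so each entry [j] of the reduced point is bounded by the
   sum of the absolute values in column [j] of [B], hence by [M]. *)
pose M := \sum_i \sum_j `|B i j|.
exists [set v : 'rV[R]_d | forall i, `[- M, M]%classic (v ord0 i)].
  apply: (@rV_compact _ _ (fun=> `[- M, M]%classic)) => _.
  exact: segment_compact.
move=> x.
pose y := x *m invmx B.
pose z : 'rV[int]_d := map_mx (fun r => - Num.floor r) y.
exists (map_mx intr z *m B); first by exists z.
move=> j /=.
have -> : x + map_mx intr z *m B = (y + map_mx intr z) *m B.
  by rewrite mulmxDl mulmxKV.
rewrite in_itv/= -ler_norml mxE.
apply: le_trans (ler_norm_sum _ _ _) _.
apply: ler_sum => i _.
have -> : (y + map_mx intr z) ord0 i = y ord0 i - (Num.floor (y ord0 i))%:~R.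
  by rewrite !mxE mulrNz.
have /andP[f0 f1] := floor_itv (y ord0 i).
rewrite normrM; apply: (@le_trans _ _ (1 * `|B i j|)).
  apply: ler_wpM2r => //.
  rewrite ger0_norm ?subr_ge0//; move: f1; rewrite intrD; lra.
rewrite mul1r (bigD1 j)//= lerDl; exact: sumr_ge0.
Qed.

Lemma periodic_bounded (R : realType) (d : nat) (L : set 'rV[R]_d)
    (f : 'rV[R]_d -> R^o) :
  full_rank_lattice L -> lattice_periodic L f -> continuous f ->
  exists M, forall x, `|f x| <= M.
Proof.
move=> /lattice_compact_reduction[K cK KL] fL fc.
have /compact_bounded[M [_ HM]] : compact (f @` K).
  by apply: continuous_compact => //; exact: continuous_subspaceT.
(* [compact_bounded] provides a bound only for constants strictly above [M]. *)
exists (M + 1) => x; have [l Ll Kxl] := KL x.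
rewrite -(fL _ Ll); apply: HM; first by rewrite ltrDl.
by exists (x + l).
Qed.

(** Continuity at a point of [K] gives the estimate for nearby base points and small [t] jointly.
    Compactness, in its near-covering form, makes the range of [t] uniform on [K], and periodicity
    carries it to all of space. *)
Lemma periodic_unif_continuous (R : realType) (d : nat) (L : set 'rV[R]_d)
    (f : 'rV[R]_d -> R^o) (v : 'rV[R]_d) (e : R) :
  full_rank_lattice L -> lattice_periodic L f -> continuous f -> 0 < e ->
  \forall t \near (0 : R), forall x, `|f (x + t *: v) - f x| <= e.
Proof.
move=> /lattice_compact_reduction[K cK KL] fL fc e0.
have : \forall t \near (0 : R), K `<=` (fun x => `|f (x + t *: v) - f x| <= e).
  apply: ((compact_near_coveringP K).1 cK R (nbhs (0 : R))
    (fun t x => `|f (x + t *: v) - f x| <= e)) => x Kx.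
  have sc : (fun z : 'rV[R]_d * R => z.1 + z.2 *: v) z
      @[z --> (x, 0 : R)] --> x.
    rewrite -[X in _ --> X]addr0 -(scale0r v).
    apply: cvgD; first exact: cvg_fst.
    by apply: cvgZr_tmp; exact: cvg_snd.
  have e2 : 0 < e / 2 by rewrite divr_gt0.
  have fe : \forall y \near x, `|f x - f y| <= e / 2.
    by move/cvgrPdist_le: (fc x); exact.
  (* The base point [z.1] moves as well, so both [z.1] and its translate are compared with [x]. *)
  have fe1 : \forall z \near (x, 0 : R), `|f x - f z.1| <= e / 2.
    exact: (cvg_fst fe).
  have fe2 : \forall z \near (x, 0 : R), `|f x - f (z.1 + z.2 *: v)| <= e / 2.
    exact: (sc _ fe).
  apply: filterS2 fe1 fe2 => z fz1 fz2 /=.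
  rewrite (splitr e) -(subrKA (f x)) (le_trans (ler_normD _ _))// lerD//.
  by rewrite distrC.
move=> H; near=> t => x.
have [l Ll Kxl] := KL x.
rewrite -(fL _ Ll) -(fL _ Ll x) addrAC.
by move: (x + l) Kxl; near: t.
Unshelve. all: by end_near. Qed.

(** * Uniform approximation by difference quotients *)

(** Only derivability in the direction [v] is assumed, so no chain rule is invoked: the difference
    quotients on both sides are equal as functions of the increment. *)
Lemma derivative_along (R : realType) (V : normedModType R) (f : V -> R^o)
    (x v : V) (t : R) :
  derivable f (x + t *: v) v ->
  is_derive t 1 (fun s : R => f (x + s *: v) : R^o) ('D_v f (x + t *: v)).
Proof.
have E : (fun h : R =>
      h^-1 *: (((fun s : R => f (x + s *: v) : R^o) \o shift t) (h *: 1)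
               - f (x + t *: v))) =
    (fun h : R => h^-1 *: ((f \o shift (x + t *: v)) (h *: v) - f (x + t *: v))).
  apply/funext => h /=; congr (_ *: (f _ - _)).
  by rewrite [_ *: 1]mulr1 scalerDl addrCA.
by move=> fd; split; rewrite /derivable /derive E.
Qed.

Lemma mean_value_along (R : realType) (V : normedModType R) (f : V -> R^o)
    (x v : V) (h : R) :
  0 <= h -> (forall y, derivable f y v) ->
  exists2 t, 0 <= t <= h & f (x + h *: v) - f x = h * 'D_v f (x + t *: v).
Proof.
move=> h0 fd.
have D t := derivative_along (fd (x + t *: v)).
have [|t] := @MVT_segment R _ _ 0 h h0 (fun t _ => D t).
  apply: derivable_within_continuous => t _; by case: (D t).
rewrite in_itv/= => ht E; exists t => //.
by move: E; rewrite scale0r addr0 subr0 mulrC.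
Qed.

Lemma lattice_periodic_partial (R : realType) (d : nat) (V : normedModType R)
    (L : set 'rV[R]_d) (f : 'rV[R]_d -> V) (i : 'I_d) :
  lattice_periodic L f -> lattice_periodic L (partial i f).
Proof.
move=> fL l Ll x; rewrite /partial /derive; congr (lim _).
congr ((fun g => g @ 0^') _); apply/funext => h /=.
by rewrite addrA !(fL _ Ll).
Qed.

(** By the mean value theorem the error is [h] times a variation of the partial derivative over a
    distance at most [h], which uniform continuity controls. *)
Lemma difference_quotient_unif (R : realType) (d : nat) (L : set 'rV[R]_d)
    (f : 'rV[R]_d -> R^o) (i : 'I_d) (e : R) :
  full_rank_lattice L -> lattice_periodic L f -> Ck 1 f -> 0 < e ->
  \forall h \near (0 : R)^'+, forall x,
    `|f (x + h *: delta_mx 0 i) - f x - h * partial i f x| <= h * e.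
Proof.
move=> hL fL [_ /(_ i)[fd [dfc _]]] e0.
have dfL : lattice_periodic L (partial i f).
  exact: lattice_periodic_partial.
have [r /= r0 Hr] := periodic_unif_continuous (delta_mx 0 i) hL dfL dfc e0.
near=> h => x.
have h0 : 0 < h by [].
have [t /andP[t0 th] ->] := mean_value_along x (ltW h0) fd.
rewrite -mulrBr normrM gtr0_norm// ler_pM2l//; apply: Hr => /=.
rewrite sub0r normrN ger0_norm//; apply: le_lt_trans th _.
by near: h; exact: nbhs_right_lt.
Unshelve. all: by end_near. Qed.

(** * Nonnegative divergences of periodic fields *)

Lemma periodic_div_ge0_eq0 (R : realType) (d : nat) (L : set 'rV[R]_d)
    (G : 'I_d -> 'rV[R]_d -> R^o) :
  full_rank_lattice L -> (forall i, lattice_periodic L (G i)) ->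
  (forall i, Ck 1 (G i)) -> (forall x, 0 <= \sum_i partial i (G i) x) ->
  forall x, \sum_i partial i (G i) x = 0.
Proof.
move=> hL GL GC; set F := fun x => \sum_i partial i (G i) x => F_ge0 x0.
have F_cont : continuous F.
  apply: continuous_big => [|i _]; first exact: add_continuous.
  by have [_ /(_ i)[_ [+ _]]] := GC i.
have shift_cvg (x t : 'rV[R]_d) : y + t @[y --> x] --> x + t.
  exact: (cvgD cvg_id (cvg_cst t)).
have Ft_cont (t : 'rV[R]_d) : continuous (fun x : 'rV[R]_d => F (x + t)).
  by move=> x; exact: (cvg_comp _ _ (shift_cvg x t) (F_cont (x + t))).
have F_per : lattice_periodic L F.
  by move=> l Ll x; apply: eq_bigr => i _; apply: lattice_periodic_partial.
apply/eqP; rewrite eq_le F_ge0 andbT leNgt; apply/negP => Fx0.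
pose c := F x0 / 2.
have c0 : 0 < c by rewrite divr_gt0.
have [K cK KL] := lattice_compact_reduction hL.
(* The open sets where [F (x + t)] exceeds [c], indexed by [t], cover [K]: the shift [x0 - x] takes
   [x] to [x0], where [F] exceeds its half [c]. *)
have [T KT] : exists T : seq 'rV[R]_d,
    forall x, K x -> exists2 t, t \in T & c < F (x + t).
  move: cK; rewrite compact_cover => /(_ 'rV[R]_d setT
    (fun t => [set x | c < F (x + t)])) [t _|x _|T _ KT].
  - apply: (@open_comp 'rV[R]_d R^o (fun x => F (x + t)) [set r | c < r]).
      by move=> x _; exact: Ft_cont.
    exact: open_gt.
  - exists (x0 - x) => //; rewrite /mkset [x + _]addrC subrK.
    by rewrite ltr_pdivrMr// ltr_pMr// ltr1n.
  - by exists (finmap.enum_fset T) => x /KT[t tT Ft]; exists t.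
have sum_ge x : c <= \sum_(t <- T) F (x + t).
  have [l Ll /KT[t tT]] := KL x.
  rewrite addrAC (F_per _ Ll) => /ltW cF.
  apply: le_trans cF _; rewrite (big_rem t tT) lerDl.
  by apply: sumr_ge0 => u _; exact: F_ge0.
(* [n] counts the difference quotients used, one per shift and direction. An error [e] in each costs
   at most [c / 2] in total, and the successor in [e] avoids a division by zero. *)
pose n := (size T * d)%N.
pose e := c / 2 / n.+1%:R.
have e0 : 0 < e by rewrite !divr_gt0.
have ne : e * n%:R <= c / 2.
  rewrite /e mulrAC ler_pdivrMr// ler_pM2l ?divr_gt0// ler_nat; exact: leqnSn.
have /filter_ex[h [h0 hG]] : \forall h \near (0 : R)^'+, 0 < h /\ forall i x,
    `|G i (x + h *: delta_mx 0 i) - G i x - h * partial i (G i) x| <= h * e.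
  near=> h; split; first by [].
  near: h; apply: filter_forall => i.
  exact: difference_quotient_unif hL (GL i) (GC i) e0.
pose s := [seq (t, i) | t <- T, i <- index_enum 'I_d].
have : h * (c / 2) <= 0.
  apply: (@sum_bounded_differences_le0 _ 'rV[R]_d _ s
    (fun q => h *: delta_mx 0 q.2) (fun q x => G q.2 (x + q.1))) => [[t i]|x] /=.
    have [M HM] := periodic_bounded hL (GL i) (GC i).1.
    by exists M => x.
  rewrite big_allpairs/=.
  (* Each difference is at least [h] times its partial derivative minus [h * e]. Summing over [T]
     and the directions leaves at least [h * (c - e * n)]. *)
  apply: (@le_trans _ _
      (\sum_(t <- T) \sum_i (h * partial i (G i) (x + t) - h * e))).
    under eq_bigr do rewrite sumrB -mulr_sumr sumr_const card_ord.
    rewrite sumrB -mulr_sumr big_const_seq count_predT iter_addr_0.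
    have -> : h * e *+ d *+ size T = h * (e * n%:R).
      by rewrite -mulrnA mulnC mulr_natr mulrnAr.
    rewrite -mulrBr ler_pM2l//; apply: le_trans (lerB (sum_ge x) ne).
    by rewrite [X in X - _]splitr addrK.
  apply: ler_sum => t _; apply: ler_sum => i _.
  have := hG i (x + t); rewrite [x + t + _]addrAC ler_norml lerBrDl.
  by move=> /andP[].
by rewrite leNgt mulr_gt0// divr_gt0.
Unshelve. all: by end_near. Qed.

(** * Coordinates and algebra of regular fields *)

Lemma partial_coord (R : realType) (d m : nat) (f : 'rV[R]_d -> 'rV[R]_m)
    (i : 'I_d) (j : 'I_m) :
  (forall x, derivable f x (delta_mx 0 i)) ->
  partial i (fun x => f x 0 j : R^o) = fun x => partial i f x 0 j.
Proof.
by move=> fd; apply/funext => x; rewrite /partial [in RHS]derive_mx// mxE.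
Qed.

Lemma Ck_coord (R : realType) (d m k : nat) (f : 'rV[R]_d -> 'rV[R]_m)
    (j : 'I_m) :
  Ck k f -> Ck k (fun x => f x 0 j : R^o).
Proof.
elim: k f => [|k IHk] f /= [fc fd]; split.
- move=> x; exact: (continuous_comp (fc x) (@coord_continuous _ _ _ 0 j _)).
- by [].
- move=> x; exact: (continuous_comp (fc x) (@coord_continuous _ _ _ 0 j _)).
- move=> i; have [fi fiC] := fd i; split => [x|].
    by have /derivable_mxP := fi x; exact.
  by rewrite partial_coord//; exact: IHk.
Qed.

Section C1Algebra.
Variables (R : realType) (d : nat).
Implicit Types f g : 'rV[R]_d -> R^o.

Lemma Ck1D f g : Ck 1 f -> Ck 1 g -> Ck 1 (f + g).
Proof.
move=> [fc fd] [gc gd]; split=> [x|i]; first exact: cvgD (fc x) (gc x).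
have [fi [fic _]] := fd i; have [gi [gic _]] := gd i.
split=> [x|]; first exact: derivableD.
have -> : partial i (f + g) = partial i f + partial i g.
  by apply/funext => x; exact: deriveD.
by split=> // x; exact: cvgD (fic x) (gic x).
Qed.

Lemma Ck1Z (k : R) f : Ck 1 f -> Ck 1 (k *: f).
Proof.
move=> [fc fd]; split=> [x|i]; first exact: cvgZl_tmp (fc x).
have [fi [fic _]] := fd i.
split=> [x|]; first exact: derivableZ.
have -> : partial i (k *: f) = k *: partial i f.
  by apply/funext => x; exact: deriveZ.
by split=> // x; exact: cvgZl_tmp (fic x).
Qed.

Lemma Ck1M f g : Ck 1 f -> Ck 1 g -> Ck 1 (f * g : _ -> R^o).
Proof.
move=> [fc fd] [gc gd]; split=> [x|i]; first exact: cvgM (fc x) (gc x).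
have [fi [fic _]] := fd i; have [gi [gic _]] := gd i.
split=> [x|]; first exact: derivableM.
have -> : partial i (f * g : _ -> R^o) =
    (f * partial i g + g * partial i f : _ -> R^o).
  by apply/funext => x; exact: deriveM.
by split=> // x; exact: cvgD (cvgM (fc x) (gic x)) (cvgM (gc x) (fic x)).
Qed.

Lemma Ck1_sum n (f : 'I_n -> 'rV[R]_d -> R^o) :
  (forall i, Ck 1 (f i)) -> Ck 1 (\sum_i f i).
Proof.
move=> fC; apply: big_ind => //; last exact: Ck1D.
split=> [x|i]; first exact: cst_continuous.
split=> [x|]; first exact: (@derivable_cst _ _ _ (0 : R^o)).
have -> : partial i (0 : 'rV[R]_d -> R^o) = 0.
  by apply/funext => x; exact: (@derive_cst _ _ _ (0 : R^o)).
by split=> // x; exact: cst_continuous.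
Qed.

End C1Algebra.

(** * The energy identity and its conclusion *)

Theorem lemma8p2 (R : realType) (d : nat) (L : set 'rV[R]_d)
    (nu tau_e : R) (alpha : 'rV[R]_d -> 'rV[R]_d) (p : 'rV[R]_d -> R^o)
    (hL : full_rank_lattice L) (hnu : 0 < nu) (htau : 0 < tau_e)
    (alpha_per : lattice_periodic L alpha) (p_per : lattice_periodic L p)
    (alpha_reg : Ck 2 alpha) (p_reg : Ck 1 p)
    (momentum : forall x, nu *: laplacian alpha x - tau_e^-1 *: alpha x = grad p x)
    (incompressible : forall x, div alpha x = 0) :
  (forall x, alpha x = 0) /\ (forall x, grad p x = 0).
Proof.
pose a j : 'rV[R]_d -> R^o := fun x => alpha x 0 j.
have aC2 j : Ck 2 (a j) by exact: Ck_coord.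
have aC1 j : Ck 1 (a j).
  by have [ac ad] := aC2 j; split=> // i; have [? [? _]] := ad i.
have daC1 i j : Ck 1 (partial i (a j)) by have [_ /(_ i)[]] := aC2 j.
have dEa i x (f : 'rV[R]_d -> R^o) : Ck 1 f -> derivable f x (delta_mx 0 i).
  by move=> [_ /(_ i)[]].
have a_per j : lattice_periodic L (a j).
  by move=> l Ll x; rewrite /a alpha_per.
have momentum_coord j x :
    nu * (\sum_i partial i (partial i (a j)) x) - tau_e^-1 * a j x =
    partial j p x.
  have /matrixP/(_ 0 j) := momentum x; rewrite !mxE => <-.
  congr (_ * _ - _); rewrite summxE; apply: eq_bigr => i _.
  have [_ /(_ i)[di [_ /(_ i)[ddi _]]]] := alpha_reg.
  by rewrite /a !partial_coord.
(* The energy flux: [nu] times the gradient of half the squared length of [alpha], minus the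
   pressure flux [p * alpha]. *)
pose G i : 'rV[R]_d -> R^o :=
  nu *: (\sum_j (a j * partial i (a j) : _ -> R^o)) - (p * a i : _ -> R^o).
have aaC1 i j : Ck 1 (a j * partial i (a j) : _ -> R^o) by exact: Ck1M.
have paC1 i : Ck 1 (p * a i : _ -> R^o) by exact: Ck1M.
have SC1 i : Ck 1 (\sum_j (a j * partial i (a j) : _ -> R^o)) by exact: Ck1_sum.
have GC1 i : Ck 1 (G i).
  by apply: Ck1D; [exact: Ck1Z|rewrite -scaleN1r; exact: Ck1Z].
have G_per i : lattice_periodic L (G i).
  move=> l Ll x; rewrite /G !fctE !fct_sumE p_per// a_per//.
  congr (_ *: _ - _); apply: eq_bigr => j _; rewrite !fctE a_per//.
  by rewrite (lattice_periodic_partial i (a_per j) Ll).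
have divG x : \sum_i partial i (G i) x =
    nu * (\sum_i \sum_j partial i (a j) x ^+ 2) + tau_e^-1 * \sum_j a j x ^+ 2.
  have dG i : partial i (G i) x =
      nu * (\sum_j a j x * partial i (partial i (a j)) x) +
      nu * (\sum_j partial i (a j) x ^+ 2) -
      (p x * partial i (a i) x + a i x * partial i p x).
    rewrite {1}/partial /G deriveB; [|exact/dEa/Ck1Z|exact: dEa].
    rewrite deriveZ; last exact: dEa.
    rewrite derive_sum => [|j]; last exact: dEa.
    rewrite deriveM; [|exact: dEa..].
    rewrite -mulrDr -big_split/=; congr (_ * _ - _).
    by apply: eq_bigr => j _; rewrite deriveM; [|exact: dEa..].
  (* Incompressibility removes the term in [p x]. The remaining terms combine, for each [j], into
     [a j] times [nu] times its Laplacian minus [partial j p], which the momentum equation turns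
     into [tau_e^-1 * a j x ^+ 2]. *)
  rewrite (eq_bigr _ (fun i _ => dG i)) sumrB !big_split/= -!mulr_sumr.
  have -> : \sum_i partial i (a i) x = 0 by exact: incompressible.
  rewrite exchange_big/= mulr0 add0r addrAC addrC; congr (_ + _).
  rewrite !mulr_sumr -sumrB; apply: eq_bigr => j _.
  rewrite -momentum_coord -mulr_sumr; ring.
have da_ge0 x : 0 <= \sum_i \sum_j partial i (a j) x ^+ 2.
  by apply: sumr_ge0 => i _; apply: sumr_ge0 => j _; exact: sqr_ge0.
have a_ge0 x : 0 <= \sum_j a j x ^+ 2.
  by apply: sumr_ge0 => j _; exact: sqr_ge0.
have F_ge0 x : 0 <= \sum_i partial i (G i) x.
  by rewrite divG addr_ge0// mulr_ge0 ?da_ge0 ?a_ge0 ?invr_ge0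
    ?(ltW hnu) ?(ltW htau).
have alpha0 x : alpha x = 0.
  apply/rowP => j; rewrite mxE.
  have /eqP := periodic_div_ge0_eq0 hL G_per GC1 F_ge0 x.
  (* Two nonnegative terms with zero sum both vanish; the one with the positive factor [tau_e^-1]
     forces every coordinate to be zero. *)
  rewrite divG paddr_eq0.
  - move=> /andP[_]; rewrite mulf_eq0 invr_eq0 gt_eqF//= psumr_eq0 => [|i _].
      by move=> /allP/(_ j); rewrite mem_index_enum sqrf_eq0 => /(_ isT)/eqP.
    exact: sqr_ge0.
  - by rewrite mulr_ge0 ?da_ge0 ?(ltW hnu).
  - by rewrite mulr_ge0 ?a_ge0 ?invr_ge0 ?(ltW htau).
(* The momentum equation now expresses the pressure gradient as [nu] times the Laplacian of the zero
   field. *)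
split=> // x; rewrite -momentum alpha0 scaler0 subr0.
have dcst0 i : partial i (fun=> 0 : 'rV[R]_d) = (fun=> 0 : 'rV[R]_d).
  by apply/funext => y; exact: derive_cst.
have -> : alpha = fun=> 0 by exact/funext.
by rewrite /laplacian big1 ?scaler0// => i _; rewrite !dcst0.
Qed.
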